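(* Let $G$ be an infinite abelian group, and let $d,H \in \mathbb{N}$ and $\vec m_1, \ldots, \vec m_H \in \mathbb{Z}^d$. Then there exist finite sets $A_1, \ldots, A_d \subseteq G$ such that, for each $1 \leq h \leq H$, the vector $$(|hA_1|, \ldots, |hA_d|)-\vec m_h \in \mathbb{Z}^d$$ is a constant vector.
   Context: $\mathbb{N}$ denotes the positive integers. For a subset $A$ of an abelian group $G$ and $h \in \mathbb{N}$, the $h$-fold iterated sumset is $hA:=\{a_1+\cdots+a_h : a_1,\ldots,a_h \in A\}$ (repetitions allowed). $|X|$ denotes the cardinality of a finite set $X$. A constant vector is a vector all of whose $d$ coordinates are equal to each other (the common value may depend on $h$). *)

(* Defs.v *)
From mathcomp Require Import all_boot all_order all_algebra.
From mathcomp Require Import finmap.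
From mathcomp Require Import classical_sets cardinality.

Set Implicit Arguments.
Unset Strict Implicit.
Unset Printing Implicit Defensive.

Import GRing.Theory.
Local Open Scope ring_scope.
Local Open Scope fset_scope.

(* The summands are indexed by all functions from 'I_h to A, so repetitions
   are allowed. *)
Definition sumset (G : zmodType) (h : nat) (A : {fset G}) : {fset G} :=
  [fset \sum_(i < h) val (a i) | a : {ffun 'I_h -> A} in {: {ffun 'I_h -> A}}].

Lemma sumsetP (G : zmodType) (h : nat) (A : {fset G}) (x : G) :
  reflect (exists2 a : 'I_h -> G, (forall i, a i \in A) & x = \sum_(i < h) a i)
          (x \in sumset h A).
Proof.
apply: (iffP (imfsetP _ _ _ _)) => [[a _ ->]|[a aA ->]].
  by exists (fun i => val (a i)) => // i; apply: valP.
exists [ffun i => [` aA i]] => //.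
by apply: eq_bigr => i _; rewrite ffunE.
Qed.

(* Main.v *)
(** Fix a finite set [A] and optional points [u_q], one for each gadget [q], so
    that every sum involving [u_q] already lies in an iterated sumset of [A],
    except the sums of [u_q] and distinct companions taken from a prescribed set
    [friends q]; these sums are new and pairwise distinct. Adding the points
    [u_q], [q \in U], then increases [|(h+1)A|] by the sum over [q \in U] of
    ['C(#|friends q|, h)]. The matrix ['C(t, h)] is unitriangular, so suitable
    numbers of gadgets with [t] friends, [t < H], realize any prescribed
    increments up to a constant.

    To absorb [u_q], take independent elements [v], [e_i] ([i] a gadget or a
    companion) and [z_p] ([p] a pair of indices), put [u_q = e_q + v], and let
    [A] contain [e_q], [e_q + 2v] and the companions [e_r]. A full element [x]
    (with [x], [x + v], [x + 2v] in [A]) absorbs [u_q], because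
    [{0, 2} + {0, 1, 2}] contains [1 + {0, 1, 2}]. A pair [e_i + e_j]
    that is not to give new sums is absorbed by making [z_(i,j)] and [e_i + e_j - z_(i,j)] full.

    An infinite abelian group contains arbitrarily many elements that are
    independent in the sense that in every relation with bounded coefficients
    all the coefficients are divisible by a fixed [N <> 1]; this weak form of
    independence suffices. *)

Require Import Defs.
From mathcomp Require Import all_boot all_order all_algebra.
From mathcomp Require Import zify ring boolp.
From mathcomp Require Import finmap classical_sets cardinality.

Set Implicit Arguments.
Unset Strict Implicit.
Unset Printing Implicit Defensive.

Import Order.TTheory GRing.Theory Num.Theory.
Local Open Scope ring_scope.

(** * Weakly independent elements of an infinite abelian group *)

Definition independent_mod (G : zmodType) (N C : nat) (J : finType)
    (b : J -> G) :=
  forall c : J -> int, (forall j, (`|c j| <= C)%N) ->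
  \sum_j b j *~ c j = 0 -> forall j, (N %| `|c j|)%N.

Lemma mulrz_absz_eq0 (G : zmodType) (x : G) (c : int) :
  (x *~ c == 0) = (x *+ `|c| == 0).
Proof. by case: c => n //; rewrite NegzE mulrNz oppr_eq0. Qed.

Section Independence.
Variable G : zmodType.
Hypothesis infG : infinite_set [set: G]%classic.

Let torsion n : set G := [set x | x *+ n = 0]%classic.

Lemma torsion_gcd (m n : nat) (x : G) :
  x *+ m = 0 -> x *+ n = 0 -> x *+ gcdn m n = 0.
Proof.
case: (posnP m) => [->|m0]; first by rewrite gcd0n.
move=> xm xn; have [a _ /dvdnP[k kE]] := Bezoutl n m0.
have : x *+ (gcdn m n + a * n) = 0 by rewrite kE mulnC mulrnA xm mul0rn.
by rewrite mulrnDr mulnC mulrnA xn mul0rn addr0.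
Qed.

(* [N] is the least positive integer whose torsion subgroup is infinite, or
   [0] if there is none. *)
Lemma exists_torsion_modulus :
  exists N, [/\ N != 1%N, infinite_set (torsion N) &
    forall m, ~~ (N %| m)%N -> finite_set (torsion N `&` torsion m)%classic].
Proof.
have [[n0 n0P]|/forallNP noN] :=
  pselect (exists n, (0 < n)%N && `[< infinite_set (torsion n) >]).
  have exn : exists n, (0 < n)%N && `[< infinite_set (torsion n) >] by exists n0.
  case: (ex_minnP exn) => N /andP[N0 /asboolP infN] minN.
  exists N; split=> //.
    apply/eqP => N1; apply: infN; apply: sub_finite_set (finite_set1 (0 : G)).
    by move=> x; rewrite /torsion N1 /= mulr1n.
  move=> m Nm; have ltN : (gcdn N m < N)%N.
    rewrite ltn_neqAle dvdn_leq ?dvdn_gcdl// andbT.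
    by apply: contra Nm => /eqP <-; apply: dvdn_gcdr.
  have g0 : (0 < gcdn N m)%N by rewrite gcdn_gt0 N0.
  have : finite_set (torsion (gcdn N m)).
    apply: contrapT => infg.
    by have := minN (gcdn N m); rewrite g0 /= leqNgt ltN; case: asboolP => // _ /(_ isT).
  by apply: sub_finite_set => x /= [xN xm]; apply: torsion_gcd.
exists 0%N; split=> //.
  by apply: sub_infinite_set infG => x _ /=; rewrite /torsion /= mulr0n.
move=> m; rewrite dvd0n -lt0n => m0.
apply: (@sub_finite_set _ _ (torsion m)) => [x []//|].
by apply: contrapT => infm; apply: (noN m); rewrite m0; apply/asboolP.
Qed.

(** Two points of the fiber differ by an element of [torsion N] killed by [c], and there are
    finitely many of these. *)
Lemma finite_fiber (N : nat) (t : G) (c : int) :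
  (forall m, ~~ (N %| m)%N -> finite_set (torsion N `&` torsion m)%classic) ->
  ~~ (N %| `|c|)%N ->
  finite_set (torsion N `&` [set x | x *~ c = t])%classic.
Proof.
move=> finN /finN fin.
have [[x0 [x0N x0t]]|/forallNP none] :=
  pselect (exists x, (torsion N `&` [set x | x *~ c = t])%classic x); last first.
  by apply: sub_finite_set (finite_set0 G) => x /none.
apply: sub_finite_set (finite_image (+%R x0) fin) => x [xN xt].
exists (x - x0); last by rewrite addrC subrK.
split; rewrite /torsion /= mulrnBl.
  by rewrite xN x0N subr0.
have : (x - x0) *~ c = 0 by rewrite mulrzBl xt x0t subrr.
by rewrite -mulrnBl => /eqP; rewrite mulrz_absz_eq0 => /eqP.
Qed.

(** Induction on [n] inside [torsion N]. The new element avoids the finitely many solutions of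
    relations whose last coefficient is not divisible by [N]. In any other relation the last term
    vanishes by torsion, and the induction hypothesis applies. *)
Lemma exists_independent_ord (C : nat) :
  exists2 N, N != 1%N & forall n, exists b : 'I_n -> G, independent_mod N C b.
Proof.
have [N [N1 infN finN]] := exists_torsion_modulus; exists N => // n.
suff [b _ ?] : exists2 b : 'I_n -> G, (forall i, torsion N (b i)) &
  independent_mod N C b by exists b.
elim: n => [|n [b bN bI]].
  by exists (fun=> 0) => [[]|c _ _ []].
(* [Z] runs through the integers from [-C] to [C], so only finitely many relations occur. *)
pose Z (k : 'I_(C + C).+1) : int := k%:Z - C%:Z.
have ZE (c : int) : (`|c| <= C)%N -> exists k, c = Z k.
  move=> cC; have lk : (`|(c + C%:Z)%R| < (C + C).+1)%N by lia.
  by exists (Ordinal lk); rewrite /Z /=; lia.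
pose bad (p : 'I_(C + C).+1 * {ffun 'I_n -> 'I_(C + C).+1}) : set G :=
  if (N %| `|Z p.1|)%N then set0 else
  (torsion N `&` [set x | x *~ Z p.1 = - \sum_i b i *~ Z (p.2 i)])%classic.
have finbad : finite_set (\bigcup_p bad p)%classic.
  apply: bigcup_finite => [|p _]; first exact: finite_finset.
  by rewrite /bad; case: ifPn => [_|/finite_fiber]; [exact: finite_set0|exact].
have : infinite_set (torsion N `\` \bigcup_p bad p)%classic.
  exact: infinite_setD.
move=> /infinite_setN0[x [xN xgood]].
exists (fun i => if unlift ord_max i is Some j then b j else x).
  by move=> i; case: unliftP => [j|] _.
move=> c cC; rewrite big_ord_recr /= unlift_none => sum0.
have bE (i : 'I_n) : unlift ord_max (widen_ord (leqnSn n) i) = Some i.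
  suff -> : widen_ord (leqnSn n) i = lift ord_max i by rewrite liftK.
  by apply: val_inj; rewrite /= /bump leqNgt ltn_ord.
have {}sum0 : \sum_(i < n) b i *~ c (widen_ord (leqnSn n) i) + x *~ c ord_max = 0.
  by rewrite -[RHS]sum0; congr (_ + _); apply: eq_bigr => i _; rewrite bE.
have [k kE] := ZE _ (cC ord_max).
have Nc : (N %| `|c ord_max|)%N.
  apply: contrapT => /negP Nc; apply: xgood.
  have /fin_all_exists[f fE] (i : 'I_n) := ZE _ (cC (widen_ord (leqnSn n) i)).
  exists (k, [ffun i => f i]) => //; rewrite /bad /= -kE (negbTE Nc); split=> //=.
  apply/eqP; rewrite -addr_eq0 addrC -[X in _ == X]sum0; apply/eqP; congr (_ + _).
  by apply: eq_bigr => i _; rewrite ffunE fE.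
move=> i; case: (unliftP ord_max i) => [j|] -> //.
suff -> : lift ord_max j = widen_ord (leqnSn n) j.
  apply: (bI (fun j => c (widen_ord (leqnSn n) j))) => //.
  rewrite -[RHS]sum0; suff -> : x *~ c ord_max = 0 by rewrite addr0.
  case/dvdnP: Nc => k' cE; apply/eqP.
  by rewrite mulrz_absz_eq0 cE mulnC mulrnA xN mul0rn.
by apply: val_inj; rewrite /= /bump leqNgt ltn_ord.
Qed.

Lemma exists_independent (C : nat) (J : finType) :
  exists N (b : J -> G), N != 1%N /\ independent_mod N C b.
Proof.
have [N N1 /(_ #|J|)[b bI]] := exists_independent_ord C.
exists N, (b \o enum_rank); split=> // c cC sum0 j.
have := bI (c \o enum_val) (fun i => cC _) _ (enum_rank j).
rewrite /= enum_rankK; apply.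
rewrite -[RHS]sum0 [RHS](reindex_onto enum_val enum_rank) => [|i _]; last exact: enum_rankK.
by apply: eq_big => [i|i _]; rewrite /= enum_valK ?eqxx.
Qed.

End Independence.

(** * Gadgets and absorption in the free abelian group [L] *)

Section Gadgets.
Variables (Q R : finType) (friends : Q -> {set R}).

Let I : finType := (Q + R)%type.
Let J : finType := option (I + I * I)%type.
Let L : zmodType := {ffun J -> int}.

Let delta (j : J) : L := [ffun j' => (j == j')%:R].
Let v := delta None.
Let e i := delta (Some (inl i)).
Let z p := delta (Some (inr p)).

(** The pairs whose sum must not give new sums: two gadgets, a gadget and a non-friend, a companion
    repeated. A mixed pair is listed with the gadget first only. *)
Let absorbing (p : I * I) : bool :=
  match p with
  | (inl _, inl _) => true
  | (inl q, inr r) => r \notin friends q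
  | (inr _, inl _) => false
  | (inr r, inr r') => r == r'
  end.

(* [inl (p, n, b)] stands for [z_p + n v] or, if [b], for
   [e_(p.1) + e_(p.2) - z_p + n v]; [inr (inl r)] for the companion [e_r];
   [inr (inr (q, b))] for [e_q] or [e_q + 2v]. *)
Definition base_code : finType := ((I * I * 'I_3 * bool) + (R + Q * bool))%type.

Let valid (k : base_code) : bool :=
  if k is inl (p, _, _) then absorbing p else true.

Let enc (k : base_code) : L :=
  match k with
  | inl (p, n, b) =>
    (if b then e p.1 + e p.2 - z p else z p) + v *+ n
  | inr (inl r) => e (inr r)
  | inr (inr (q, b)) => e (inl q) + v *+ b.*2
  end.

Let gadget q : L := e (inl q) + v.

Let is_friend q (k : base_code) : bool :=
  if k is inr (inl r) then r \in friends q else false.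

Ltac pointwise := apply/ffunP => j; rewrite !ffunE ?ffunMnE; ring.

Lemma absorb_base q k : valid k -> ~~ is_friend q k ->
  exists k1 k2, [/\ valid k1, valid k2 & gadget q + enc k = enc k1 + enc k2].
Proof.
pose o1 : 'I_3 := Ordinal (isT : 1 < 3)%N.
pose o2 : 'I_3 := Ordinal (isT : 2 < 3)%N.
case: k => [[[p n] b] pabs _|[r _ rF|[q' b] _ _]] /=.
(* A full element: [n + 1] is split as 0 or 2, carried by [e_q], plus a shift in {0, 1, 2}. *)
- have [n' [b' nE]] : exists (n' : 'I_3) (b' : bool), n.+1 = (b'.*2 + n')%N.
    case: n pabs => [[|[|[]]] // n3] _.
    + by exists o1, false.
    + by exists ord0, true.
    + by exists o1, true.
  exists (inr (inr (q, b'))), (inl (p, n', b)); split=> //=.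
  rewrite [RHS]addrACA -mulrnDr -nE mulrS /gadget.
  by case: b {pabs}; pointwise.
- exists (inl ((inl q, inr r), o1, false)), (inl ((inl q, inr r), ord0, true)).
  by split=> //=; rewrite /gadget; pointwise.
- pose n := if b then o2 else ord0.
  exists (inl ((inl q, inl q'), o1, false)), (inl ((inl q, inl q'), n, true)).
  by split=> //=; rewrite {}/n /gadget; case: b; pointwise.
Qed.

Let companions (S : {set R}) : L := \sum_(r in S) e (inr r).

(** A term that is not a friend absorbs [u_q] at once, and so does a friend occurring twice;
    otherwise the terms are distinct friends. *)
Lemma absorb_seq q (s : seq base_code) : all valid s ->
  (exists s', [/\ all valid s', size s' = (size s).+1 &
     gadget q + \sum_(k <- s) enc k = \sum_(k <- s') enc k]) \/
  (exists S : {set R}, [/\ S \subset friends q, #|S| = size s &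
     \sum_(k <- s) enc k = companions S]).
Proof.
elim: s => [|k s IHs] /= => [_|/andP[kv sv]].
  by right; exists finset.set0; rewrite finset.sub0set cards0 /companions big_set0 big_nil.
rewrite big_cons; have [[s' [s'v sz sE]]|[S [SF sz sE]]] := IHs sv.
  left; exists (k :: s'); split; rewrite /= ?kv ?sz//.
  by rewrite big_cons -sE addrCA.
pose enumS (T : {set R}) : seq base_code := [seq inr (inl r) | r <- enum T].
have enumSv T : all valid (enumS T) by apply/allP => _ /mapP[r _ ->].
have enumSE T : \sum_(k <- enumS T) enc k = companions T.
  by rewrite big_map big_enum.
have [kF|kNF] := boolP (is_friend q k); last first.
  have [k1 [k2 [k1v k2v kE]]] := absorb_base kv kNF.
  left; exists [:: k1, k2 & enumS S]; rewrite /= k1v k2v enumSv.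
  by split; rewrite ?size_map -?cardE ?sz// !big_cons enumSE sE !addrA kE.
case: k kF {kv} => [//|[r|//]] /= rF; have [rS|rNS] := boolP (r \in S); last first.
  right; exists (r |: S); rewrite finset.subUset finset.sub1set rF SF cardsU1 rNS sz; split=> //.
  by rewrite sE /companions big_setU1.
(* The repeated companion is rewritten by [2e_r = z_(r,r) + (2e_r - z_(r,r))], and the full element
   [z_(r,r)] absorbs [u_q]. *)
left; have [k1 [k2 [k1v k2v kE]]] :=
  @absorb_base q (inl ((inr r, inr r), ord0, false)) (eqxx r) isT.
exists [:: k1, k2, inl ((inr r, inr r), ord0, true) & enumS (S :\ r)].
rewrite /= k1v k2v enumSv eqxx; split=> //.
  by rewrite size_map -cardE -sz (cardsD1 r S) rS.
rewrite !big_cons enumSE [RHS]addrA -kE sE /companions (big_setD1 r rS) /= !addr0.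
by rewrite !addrA; congr (_ + _); pointwise.
Qed.

Let extended_valid (U : {set Q}) (k : base_code + Q) : bool :=
  match k with inl k => valid k | inr q => q \in U end.

Let extended_enc (k : base_code + Q) : L :=
  match k with inl k => enc k | inr q => gadget q end.

Lemma gadget_sums (U : {set Q}) (s : seq (base_code + Q)) :
  all (extended_valid U) s ->
  (exists s', [/\ all valid s', size s' = size s &
     \sum_(k <- s) extended_enc k = \sum_(k <- s') enc k]) \/
  (exists q (S : {set R}), [/\ q \in U, S \subset friends q, #|S|.+1 = size s &
     \sum_(k <- s) extended_enc k = gadget q + companions S]).
Proof.
elim: s => [|k s IHs] /= => [_|/andP[kv sv]].
  by left; exists [::]; rewrite !big_nil.
rewrite big_cons; have [[s' [s'v sz sE]]|[q [S [qU SF sz sE]]]] := IHs sv.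
  case: k kv => [k|q] /= kv.
    by left; exists (k :: s'); rewrite /= kv s'v sz big_cons sE.
  have [[t [tv tsz tE]]|[S [SF Ssz SE]]] := absorb_seq q s'v.
    by left; exists t; rewrite tv tsz sz sE tE.
  by right; exists q, S; rewrite kv SF Ssz sz sE SE.
pose t : seq base_code := [seq inr (inl r) | r <- enum S].
have tv : all valid t by apply/allP => _ /mapP[r _ ->].
have tE : \sum_(k <- t) enc k = companions S by rewrite big_map big_enum.
have tsz : size t = #|S| by rewrite size_map -cardE.
case: k kv => [k|q'] /= kv.
  have ktv : all valid (k :: t) by rewrite /= kv.
  have [[u [uv usz uE]]|[T [TF Tsz TE]]] := absorb_seq q ktv.
    left; exists u; split=> //; first by rewrite usz /= tsz sz.
    by rewrite sE -uE big_cons tE addrCA.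
  right; exists q, T; split=> //; first by rewrite Tsz /= tsz sz.
  by rewrite sE -TE big_cons tE addrCA.
(* Two gadgets absorb each other: with [z = z_(q,q')], [u_q + u_q' = (z + v) + (e_q + e_q' - z +
   v)]. *)
pose o1 : 'I_3 := Ordinal (isT : 1 < 3)%N.
left; exists [:: inl ((inl q, inl q'), o1, false), inl ((inl q, inl q'), o1, true) & t].
split=> //; first by rewrite /= tsz sz.
rewrite sE !big_cons tE /= !addrA; congr (_ + _); rewrite /gadget; pointwise.
Qed.

(** * Transfer to [G]: the new sums are distinct and really new *)

Variables (G : zmodType) (N C : nat) (b : J -> G).
Hypotheses (N1 : N != 1%N) (bI : independent_mod N C b).

Let lc (x : L) : G := \sum_j b j *~ x j.

Lemma lcD : {morph lc : x y / x + y}.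
Proof.
by move=> x y; rewrite /lc -big_split; apply: eq_bigr => j _; rewrite ffunE mulrzDr.
Qed.

Lemma lc0 : lc 0 = 0.
Proof. by rewrite /lc big1// => j _; rewrite ffunE. Qed.

Lemma lc_sum (T : Type) (s : seq T) (F : T -> L) :
  lc (\sum_(k <- s) F k) = \sum_(k <- s) lc (F k).
Proof. exact: (big_morph lc lcD lc0). Qed.

Lemma lc_inj_mod (x y : L) : (forall j, (`|(x j - y j)%R| <= C)%N) ->
  lc x = lc y -> forall j, (N %| `|(x j - y j)%R|)%N.
Proof.
move=> bnd xy; apply: bI => //.
rewrite -[RHS](subrr (lc x)) {2}xy /lc -sumrB.
by apply: eq_bigr => j _; rewrite mulrzBr.
Qed.

Lemma companionsE S j :
  companions S j = (if j is Some (inl (inr r)) then r \in S else false)%:R.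
Proof.
rewrite /companions sum_ffunE; case: j => [[[q|r]|p]|] /=;
  try by rewrite big1// => r _; rewrite ffunE.
have [rS|rNS] := boolP (r \in S).
  rewrite (big_setD1 r rS) /= ffunE eqxx big1 ?addr0// => r' /setD1P[r'r _].
  by rewrite ffunE; case: eqP => // -[r'E]; rewrite r'E eqxx in r'r.
by rewrite big1// => r' r'S; rewrite ffunE; case: eqP => // -[r'E]; rewrite -r'E r'S in rNS.
Qed.

(** A crude bound adding the terms: three unit vectors and at most [2v]. *)
Lemma enc_bound k j : (`|enc k j| <= 5)%N.
Proof.
have db i : exists c : bool, delta i j = c%:R by rewrite ffunE; eexists.
case: k => [[[p n] c]|[r|[q c]]] /=.
- have [c1 E1] := db (Some (inl p.1)); have [c2 E2] := db (Some (inl p.2)).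
  have [c3 E3] := db (Some (inr p)); have [c4 E4] := db None.
  have n2 := ltn_ord n.
  rewrite ffunE ffunMnE E4; case: c; rewrite ?(ffunE, E1, E2, E3); lia.
- by have [c ->] := db (Some (inl (inr r))); case: c.
- have [c1 E1] := db (Some (inl (inl q))); have [c4 E4] := db None.
  by rewrite ffunE ffunMnE E4 E1; lia.
Qed.

Lemma gadget_companions_bound q S j : (`|((gadget q + companions S) j)%R| <= 3)%N.
Proof.
rewrite !ffunE companionsE; do 2![case: (_ == _)];
  by case: j => [[[q'|r]|p]|] //=; case: (r \in S).
Qed.

(** The coordinates at the [e_i] are 0 or 1, so a difference divisible by [N <> 1] is 0. *)
Lemma gadget_companions_inj q S q' S' : (6 <= C)%N ->
  lc (gadget q + companions S) = lc (gadget q' + companions S') ->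
  q = q' /\ S = S'.
Proof.
move=> C6 /lc_inj_mod div.
have {}div j : (N %| `|((gadget q + companions S) j - (gadget q' + companions S') j)%R|)%N.
  apply: div => j'; apply: leq_trans C6.
  by have := gadget_companions_bound q S j'; have := gadget_companions_bound q' S' j'; lia.
split.
  have := div (Some (inl (inl q))); rewrite !ffunE !companionsE !eqxx /=.
  have [[->]//|_] := eqVneq (Some (inl (inl q'))) (Some (inl (inl q)) : J).
  by rewrite dvdn1 (negbTE N1).
apply/setP => r; have := div (Some (inl (inr r))); rewrite !ffunE !companionsE /= !add0r.
by case: (r \in S); case: (r \in S') => //; rewrite dvdn1 (negbTE N1).
Qed.

Lemma add_at (x y : L) j : (x + y) j = x j + y j.
Proof. by rewrite ffunE. Qed.

Lemma opp_at (x : L) j : (- x) j = - x j.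
Proof. by rewrite ffunE. Qed.

Lemma enc_at_z k p : enc k (Some (inr p)) =
  if k is inl (p', _, c) then (-1) ^+ c * (p' == p)%:R else 0.
Proof.
have zE p' : z p' (Some (inr p)) = (p' == p)%:R by rewrite ffunE.
have vE n : (v *+ n) (Some (inr p)) = 0 by rewrite ffunMnE ffunE mul0rn.
have eE i : e i (Some (inr p)) = 0 by rewrite ffunE.
case: k => [[[p' n] []]|[r|[q c]]] /=; rewrite ?add_at ?opp_at ?vE ?zE ?eE ?addr0 //.
- by rewrite add0r mulN1r.
- by rewrite mul1r.
Qed.

Lemma enc_at_v k : enc k None =
  match k with
  | inl (_, n, _) => n%:R
  | inr (inl _) => 0
  | inr (inr (_, c)) => c.*2%:R
  end.
Proof.
have zE p : z p None = 0 by rewrite ffunE.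
have vE n : (v *+ n) None = n%:R by rewrite ffunMnE ffunE.
have eE i : e i None = 0 by rewrite ffunE.
by case: k => [[[p' n] []]|[r|[q c]]] /=; rewrite ?add_at ?opp_at ?vE ?zE ?eE ?subr0 ?add0r.
Qed.

Let support (k : base_code) : seq I :=
  match k with
  | inl (p, _, true) => [:: p.1; p.2]
  | inl (_, _, false) => [::]
  | inr (inl r) => [:: inr r]
  | inr (inr (q, _)) => [:: inl q]
  end.

Lemma mem_support k i : enc k (Some (inl i)) != 0 -> i \in support k.
Proof.
have zE p : z p (Some (inl i)) = 0 by rewrite ffunE.
have vE n : (v *+ n) (Some (inl i)) = 0 by rewrite ffunMnE ffunE mul0rn.
have eE i' : e i' (Some (inl i)) = (i == i')%:R by rewrite ffunE eq_sym.
case: k => [[[p n] []]|[r|[q c]]] /=; rewrite ?add_at ?opp_at ?vE ?zE ?eE ?subr0 ?addr0 //.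
- by rewrite !inE; case: (i == p.1); case: (i == p.2).
- by rewrite inE; case: (i == inr r).
- by rewrite inE; case: (i == inl q).
Qed.

Let footprint q (S : {set R}) : {set I} := inl q |: [set inr r | r in S].

(** [S] consists of distinct friends of [q], so the only absorbing pairs inside the footprint are
    diagonal. *)
Lemma support_footprint q (S : {set R}) k i i' :
  S \subset friends q -> valid k -> i \in footprint q S -> i' \in footprint q S ->
  i \in support k -> i' \in support k -> i = i'.
Proof.
move=> /fintype.subsetP SF; case: k => [[[[p p'] n] []]|[r|[q' c]]] //= pp' iT i'T;
  rewrite ?inE; last 2 first.
- by move=> /eqP -> /eqP ->.
- by move=> /eqP -> /eqP ->.
have pE : p \in footprint q S -> p' \in footprint q S -> p = p'.
  move=> /setU1P[pE|/imsetP[r rS pE]] /setU1P[p'E|/imsetP[r' r'S p'E]];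
    move: pp'; rewrite pE p'E //= ?(SF _ r'S) //.
  by move=> /eqP ->.
by move=> /orP[] /eqP iE /orP[] /eqP i'E; subst=> //; [|apply/esym]; apply: pE.
Qed.

(* The [h] coordinates of the right-hand side along [footprint q S] are [1], so
   each needs a summand on the left that covers it; no summand covers two of
   them, hence each of the [h] summands covers exactly one. *)
Lemma gadget_companions_notin h (F : 'I_h -> base_code) q (S : {set R}) :
  (forall l, valid (F l)) -> S \subset friends q -> #|S|.+1 = h ->
  (5 * h + 3 <= C)%N -> \sum_l lc (enc (F l)) <> lc (gadget q + companions S).
Proof.
move=> Fv SF Sh hC; rewrite -lc_sum => /lc_inj_mod div.
have {}div j : (N %| `|(\sum_l enc (F l) j - (gadget q + companions S) j)%R|)%N.
  rewrite -sum_ffunE; apply: div => j'; apply: leq_trans hC; rewrite sum_ffunE.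
  have bnd : (`|(\sum_l enc (F l) j')%R| <= 5 * h)%N.
    have -> : (5 * h = \sum_(l < h) 5)%N by rewrite sum_nat_const card_ord mulnC.
    elim/big_ind2: _ => // [x1 y1 x2 y2 le1 le2|l _]; last exact: enc_bound.
    by lia.
  move: bnd (gadget_companions_bound q S j').
  by move: (\sum_l _) ((gadget q + _) j') => x y; lia.
have cover i : exists l, i \in footprint q S -> i \in support (F l).
  have h0 : (0 < h)%N by rewrite -Sh.
  have [iT|iNT] := boolP (i \in footprint q S); last by exists (Ordinal h0).
  have [l lP|none] := pickP (fun l => i \in support (F l)); first by exists l.
  have := div (Some (inl i)); rewrite big1 => [|l _]; last first.
    by apply: contraFeq (none l) => /mem_support.
  rewrite !ffunE companionsE; case/setU1P: iT => [->|/imsetP[r rS ->]] /=.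
    by rewrite eqxx dvdn1 (negbTE N1).
  by rewrite rS dvdn1 (negbTE N1).
have [f fP] := fin_all_exists cover.
have f_inj : {in footprint q S &, injective f}.
  move=> i i' iT i'T fE; apply: (support_footprint SF (Fv (f i)) iT i'T (fP _ iT)).
  by rewrite fE; apply: fP.
have f_onto l : exists2 i, i \in footprint q S & l = f i.
  apply/imsetP; have /eqP -> : f @: footprint q S == [set: 'I_h]; last by rewrite finset.in_setT.
  rewrite eqEcard finset.subsetT cardsT card_ord card_in_imset// /footprint.
  rewrite cardsU1 card_imset; last by move=> ? ? [].
  have -> : inl q \notin [set inr r | r in S] by apply/imsetP => -[].
  by rewrite -Sh /= leqnn.
have f_uniq l i : i \in footprint q S -> i \in support (F l) -> l = f i.
  move=> iT il; have [i' i'T lE] := f_onto l; rewrite lE; congr f; subst l.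
  exact: (support_footprint SF (Fv _) i'T iT (fP _ i'T) il).
(* Every summand covers some index, whereas a [z_p] half has empty support. *)
have no_z l p n : F l <> inl (p, n, false).
  by move=> Fl; have [i iT lE] := f_onto l; have := fP i iT; rewrite -lE Fl.
(* The term [-z_p] could only be offset by a [z_p] half, now excluded. Another summand with the same
   [p] would cover the same index. So the coordinate at [z_p] would be -1 instead of 0 modulo
   [N]. *)
have no_full l p n c : F l <> inl (p, n, c).
  case: c => [Fl|]; last exact: no_z.
  have [i iT lE] := f_onto l; have := fP i iT; rewrite -lE Fl => ip.
  have := div (Some (inr p)); rewrite (bigD1 l)//= big1 => [|l' ll'].
    by rewrite !ffunE companionsE Fl enc_at_z eqxx dvdn1 (negbTE N1).
  rewrite enc_at_z; case Fl': (F l') => [[[p' n'] []]|//].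
    have [p'p|_] := eqVneq p' p; last by rewrite mulr0.
    have := f_uniq l' i iT; rewrite Fl' p'p => /(_ ip) l'E.
    by rewrite l'E -lE eqxx in ll'.
  by case: (no_z _ _ _ Fl').
(* Comparison at [v]: the summand covering [q] gives 0 or 2, the companions give 0, but [u_q] has
   1. *)
have qT : inl q \in footprint q S by rewrite inE inE eqxx.
have := div None; rewrite (bigD1 (f (inl q)))//= big1 => [|l lq].
  rewrite !ffunE companionsE eqxx /= enc_at_v.
  have := fP _ qT; case Fl : (F _) => [[[p n] c]|[r|[q' []]]] //= _.
  - by case: (no_full _ _ _ _ Fl).
  - by rewrite dvdn1 (negbTE N1).
  - by rewrite dvdn1 (negbTE N1).
rewrite enc_at_v; case Fl : (F l) => [[[p n] c]|[r|[q' c]]] //=.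
  by case: (no_full _ _ _ _ Fl).
have [i iT lE] := f_onto l; have := fP i iT; rewrite -lE Fl inE => /eqP iE.
case/setU1P: iT => [iq|/imsetP[r _ ir]]; last by rewrite iE in ir.
by rewrite lE iq eqxx in lq.
Qed.

(** * Counting the iterated sumsets of the extended sets *)

Let extended (U : {set Q}) : {fset G} :=
  [fset x in [seq lc (extended_enc k) | k <- enum {: base_code + Q} &
                                       extended_valid U k]]%fset.

Lemma extendedP U x :
  reflect (exists2 k, extended_valid U k & x = lc (extended_enc k)) (x \in extended U).
Proof.
rewrite in_fset; apply: (iffP mapP) => -[k kU ->]; exists k => //.
  by move: kU; rewrite mem_filter => /andP[].
by rewrite mem_filter kU mem_enum.
Qed.

Lemma sumset_extended U (s : seq (base_code + Q)) : all (extended_valid U) s ->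
  lc (\sum_(k <- s) extended_enc k) \in sumset (size s) (extended U).
Proof.
move=> /allP sU; apply/sumsetP; exists (fun i => lc (extended_enc (tnth (in_tuple s) i))).
  by move=> i; apply/extendedP; exists (tnth (in_tuple s) i) => //; apply/sU/mem_tnth.
by rewrite lc_sum (big_tnth _ _ s).
Qed.

Lemma extended_sumset U h x : x \in sumset h (extended U) ->
  exists F : 'I_h -> base_code + Q,
    (forall i, extended_valid U (F i)) /\ x = \sum_i lc (extended_enc (F i)).
Proof.
case/sumsetP => a aU ->.
have /fin_all_exists2[F FU FE] := fun i => extendedP U (a i) (aU i).
by exists F; split=> //; apply: eq_bigr => i _.
Qed.

Let new_pairs (U : {set Q}) h : {set Q * {set R}} :=
  [set p : Q * {set R} | [&& p.1 \in U, p.2 \subset friends p.1 & #|p.2| == h]].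

Let new_sums U h : {fset G} :=
  [fset x in [seq lc (gadget p.1 + companions p.2) | p <- enum (new_pairs U h)]]%fset.

Lemma card_new_pairs U h : #|new_pairs U h| = (\sum_(q in U) 'C(#|friends q|, h))%N.
Proof.
under eq_bigr => q _ do rewrite -cards_draws -sum1_card.
rewrite pair_big_dep /= -sum1_card; apply: eq_bigl => -[q S].
by rewrite !inE.
Qed.

Lemma card_new_sums U h : (6 <= C)%N ->
  #|` new_sums U h|%fset = (\sum_(q in U) 'C(#|friends q|, h))%N.
Proof.
move=> C6; rewrite -card_new_pairs card_fseq undup_id ?size_map -?cardE//.
rewrite map_inj_uniq ?enum_uniq// => -[q S] [q' S'].
by move=> /(gadget_companions_inj C6)[/= -> ->].
Qed.

(** [gadget_sums] sorts the sums into these two kinds. A new sum uses one gadget and [h] companions,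
    hence the index [h.+1]. *)
Lemma sumset_extendedU U h :
  sumset h.+1 (extended U) = (sumset h.+1 (extended finset.set0) `|` new_sums U h)%fset.
Proof.
have base_sum V (s : seq base_code) : all valid s ->
    lc (\sum_(k <- s) enc k) \in sumset (size s) (extended V).
  move=> sv; have := @sumset_extended V [seq inl k | k <- s].
  by rewrite all_map size_map big_map; apply.
apply/fsetP => x; apply/idP/fsetUP => [|[]].
- case/extended_sumset => F [FU ->]; rewrite -lc_sum.
  have sU : all (extended_valid U) [seq F i | i <- enum 'I_h.+1].
    by apply/allP => _ /mapP[i _ ->].
  have := gadget_sums sU; rewrite size_map -cardE card_ord big_map big_enum /=.
  case=> [[s' [s'v s'h ->]]|[q [S [qU SF Sh ->]]]].
    by left; rewrite -s'h; apply: base_sum.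
  right; rewrite in_fset; apply/mapP; exists (q, S) => //.
  by rewrite mem_enum inE qU SF /= -eqSS Sh.
- case/extended_sumset => F [FU ->].
  rewrite -lc_sum.
  have := @sumset_extended U [seq F i | i <- enum 'I_h.+1].
  rewrite size_map -cardE card_ord big_map big_enum; apply.
  by apply/allP => _ /mapP[i _ ->]; have := FU i; case: (F i) => //= q; rewrite inE.
- rewrite in_fset => /mapP[[q S]]; rewrite mem_enum inE => /and3P[/= qU SF /eqP Sh] ->.
  have := @sumset_extended U (inr q :: [seq inl (inr (inl r)) | r <- enum S]).
  rewrite big_cons big_map big_enum /= size_map -cardE Sh; apply; rewrite qU.
  by apply/allP => _ /mapP[r _ ->].
Qed.

Lemma card_sumset_extended U h : (5 * h.+1 + 3 <= C)%N ->
  #|` sumset h.+1 (extended U)|%fset =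
  (#|` sumset h.+1 (extended finset.set0)|%fset + \sum_(q in U) 'C(#|friends q|, h))%N.
Proof.
move=> hC; rewrite sumset_extendedU cardfsU card_new_sums; last by lia.
suff /eqP -> : (sumset h.+1 (extended finset.set0) `&` new_sums U h == fset0)%fset.
  by rewrite cardfs0 subn0.
rewrite -[_ == _]/(fdisjoint _ _); apply/fdisjointP => x.
case/extended_sumset => F [FU xE]; rewrite in_fset; apply/mapP => -[[q S]].
rewrite mem_enum inE xE => /and3P[/= qU SF /eqP Sh].
have /fin_all_exists2[F' F'v FE] l : exists2 k, valid k & F l = inl k.
  by have := FU l; case: (F l) => [k|q'] /=; [exists k|rewrite inE].
under eq_bigr => l _ do rewrite FE.
by apply: gadget_companions_notin; rewrite ?Sh.
Qed.

End Gadgets.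

Lemma gadget_family (G : zmodType) (Q R : finType) (friends : Q -> {set R}) (H : nat) :
  infinite_set [set: G]%classic ->
  exists A : {set Q} -> {fset G}, forall h, (h < H)%N -> exists c : nat, forall U,
    #|` sumset h.+1 (A U)|%fset = (c + \sum_(q in U) 'C(#|friends q|, h))%N.
Proof.
move=> infG.
(* The bound [5 * H + 3] serves all [h.+1 <= H], so one choice of elements works for every [h]. *)
have [N [b [N1 bI]]] := exists_independent infG (5 * H + 3)
  (option ((Q + R) + (Q + R) * (Q + R))%type).
eexists => h hH; eexists => U; apply: (card_sumset_extended friends N1 bI); lia.
Qed.

(** * Choosing the numbers of gadgets *)

Lemma binomial_system (d H : nat) (m : 'I_H -> 'rV[int]_d) :
  exists x : 'M[int]_(d, H),
    forall i (h : 'I_H), \sum_t x i t * ('C(t, h))%:Z = m h 0 i.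
Proof.
pose P : 'M[int]_H := \matrix_(t, h) ('C(t, h))%:Z.
have Pu : P \in unitmx.
  rewrite unitmxE det_trig; last first.
    by apply/is_trig_mxP => t h th; rewrite mxE bin_small.
  by rewrite big1 ?unitr1// => t _; rewrite mxE binn.
exists ((\matrix_(i, h) m h 0 i) *m invmx P) => i h.
have /matrixP/(_ i h) := mulmxKV Pu (\matrix_(i, h) m h 0 i).
by rewrite !mxE => <-; apply: eq_bigr => t _; rewrite [P _ _]mxE.
Qed.

Lemma card_ord_ltn (n k : nat) : (k <= n)%N -> #|[set j : 'I_n | (j < k)%N]| = k.
Proof.
move=> kn; rewrite cardsE -sum1_card.
by rewrite -(big_ord_widen n (fun=> 1%N) kn) sum1_card card_ord.
Qed.

Local Open Scope fset_scope.

Theorem corollary1p5 (G : zmodType) (d H : nat) (m : 'I_H -> 'rV[int]_d) :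
  infinite_set [set: G]%classic -> (0 < d)%N -> (0 < H)%N ->
  exists A : 'I_d -> {fset G},
    forall h : 'I_H, exists c : int,
      \row_(i < d) (#|` sumset h.+1 (A i)|%:Z) - m h = const_mx c.
Proof.
move=> infG _ _; have [x xE] := binomial_system m.
(* Adding [M] to every solution entry makes it a legitimate number of copies, between 0 and
   [M + M]. *)
pose M := (\sum_(p : 'I_d * 'I_H) `|x p.1 p.2|)%N.
have xM i t : (`|x i t| <= M)%N by rewrite /M (bigD1 (i, t))//= leq_addr.
(* The gadget [(t, k)] is the copy number [k] of a gadget with [t] friends; [U i] below takes the
   first [x i t + M] copies. *)
pose friends (q : 'I_H * 'I_(M + M)) := [set j : 'I_H | (j < q.1)%N].
have [A AE] := gadget_family friends H infG.
pose U (i : 'I_d) :=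
  [set q : 'I_H * 'I_(M + M) | (q.2 < `|(x i q.1 + M%:Z)%R|)%N].
exists (A \o U) => h; have [c {}AE] := AE h (ltn_ord h).
(* The shift by [M] contributes the same amount for every [i], so it joins the constant. *)
exists (c%:Z + \sum_(t < H) M%:Z * ('C(t, h))%:Z)%R.
apply/rowP => i; rewrite !mxE /= AE -xE PoszD -addrA; congr (_ + _)%R.
apply/eqP; rewrite subr_eq; apply/eqP.
transitivity (Posz (\sum_(t < H) `|(x i t + M%:Z)%R| * 'C(t, h))%N); last first.
  rewrite (big_morph Posz PoszD erefl) -[RHS]big_split; apply: eq_bigr => t _ /=.
  by rewrite -mulrDl PoszM; congr (_ * _)%R; have := xM i t; lia.
congr Posz.
transitivity (\sum_(t < H) \sum_(k < M + M | (k < `|(x i t + M%:Z)%R|)%N) 'C(t, h))%N.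
  rewrite pair_big_dep /=; apply: eq_big => [q|q _]; first by rewrite inE.
  by rewrite card_ord_ltn// ltnW.
apply: eq_bigr => t _; rewrite sum_nat_const; congr (_ * _)%N.
by rewrite -[RHS](@card_ord_ltn (M + M)) ?cardsE//; have := xM i t; lia.
Qed.
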